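(* Let $(X_t)_{t\ge0}$ be a $d$-dimensional Cauchy process with infinitesimal generator $(A,\mathcal{D}(A))$. Then there exists a function $f\in C_\infty^1(\mathbb{R}^d)$ which is not in $\mathcal{D}(A)$.
   Context: The $d$-dimensional Cauchy process is the isotropic $1$-stable Lévy process in $\mathbb{R}^d$, i.e. the Lévy process with $\mathbb{E}\exp(i\xi\cdot X_t)=\exp(-t|\xi|)$, $t\ge0$, $\xi\in\mathbb{R}^d$. $C_\infty(\mathbb{R}^d)$ is the space of continuous functions $\mathbb{R}^d\to\mathbb{R}$ vanishing at infinity, and $C_\infty^1(\mathbb{R}^d)$ is the space of functions $f$ which, together with their first-order partial derivatives, belong to $C_\infty(\mathbb{R}^d)$. With $P_tf(x)=\mathbb{E}f(x+X_t)$, the generator is: $\mathcal{D}(A)$ is the set of $f\in C_\infty(\mathbb{R}^d)$ for which there is $g\in C_\infty(\mathbb{R}^d)$ with $\lim_{t\to0}\|t^{-1}(P_tf-f)-g\|_\infty=0$, and then $Af:=g$. *)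

(* Defs.v *)
From HB Require Import structures.
From mathcomp Require Import all_boot all_order all_algebra.
From mathcomp Require Import all_classical all_reals all_analysis.
From mathcomp Require Import complex.

Set Implicit Arguments.
Unset Strict Implicit.
Unset Printing Implicit Defensive.

Import Order.TTheory GRing.Theory Num.Theory.
Import numFieldNormedType.Exports.

Local Open Scope classical_set_scope.
Local Open Scope ring_scope.

Section EuclideanSpace.
Context {R : realType} {d : nat}.
Implicit Types (x y : 'rV[R]_d) (f : 'rV[R]_d -> R).

Definition dotprod x y : R := \sum_(i < d) x ord0 i * y ord0 i.

(* The library norm `|x| on 'rV[R]_d is the maximum norm; the Cauchy process
   is defined through the Euclidean one. *)
Definition enorm x : R := Num.sqrt (dotprod x x).

Definition vanishes_at_infinity f : Prop :=
  forall e : R, 0 < e -> exists M : R, forall x, M < enorm x -> `|f x| < e.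

Definition C_infty f : Prop := continuous f /\ vanishes_at_infinity f.

Definition basis_vec (i : 'I_d) : 'rV[R]_d := delta_mx ord0 i.

Definition C1_infty f : Prop :=
  C_infty f /\
  forall i : 'I_d, (forall x, derivable f x (basis_vec i)) /\
                   C_infty (fun x => 'D_(basis_vec i) f x).

(* Extended-real valued, so that unbounded functions have norm +oo. *)
Definition supnorm f : \bar R := ereal_sup [set (`|f x|)%:E | x in [set: 'rV[R]_d]].

End EuclideanSpace.

(* A copy of 'rV[R]_d, since row vectors carry no canonical measurable structure
   in the library. *)
Definition borelRV (R : realType) (d : nat) :=
  g_sigma_algebraType [set A : set 'rV[R]_d | open A].

Section LevyProcess.
Context {R : realType} {d : nat} {disp : measure_display}
  {Omega : measurableType disp} (P : probability Omega R).

Definition random_vector (Y : Omega -> 'rV[R]_d) : Prop :=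
  measurable_fun [set: Omega] (Y : Omega -> borelRV R d).

(* Taking B i = setT for some of the i gives the product rule for all
   subfamilies. *)
Definition mutually_independent (n : nat) (Y : 'I_n -> Omega -> 'rV[R]_d) : Prop :=
  forall B : 'I_n -> set (borelRV R d), (forall i, measurable (B i)) ->
  P (\bigcap_(i in [set: 'I_n]) (Y i @^-1` B i)) =
  (\prod_(i < n) P (Y i @^-1` B i))%E.

Definition same_law (Y Z : Omega -> 'rV[R]_d) : Prop :=
  forall B : set (borelRV R d), measurable B -> P (Y @^-1` B) = P (Z @^-1` B).

Definition cadlag (u : R -> 'rV[R]_d) : Prop :=
  (forall t : R, 0 <= t -> u s @[s --> t^'+] --> u t) /\
  (forall t : R, 0 < t -> cvg (u s @[s --> t^'-])).

(* Processes are indexed by R; only their values at times t >= 0 matter. *)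
Record levy_process (X : R -> Omega -> 'rV[R]_d) : Prop := {
  levy_random_vector : forall t : R, 0 <= t -> random_vector (X t);
  levy_start0 : {ae P, forall w, X 0 w = 0};
  levy_independent_increments :
    forall (n : nat) (t : nat -> R), 0 <= t 0%N ->
      (forall i, (i < n)%N -> t i <= t i.+1) ->
      mutually_independent (fun (i : 'I_n) w => X (t i.+1) w - X (t i) w);
  levy_stationary_increments :
    forall s h : R, 0 <= s -> 0 <= h ->
      same_law (fun w => X (s + h) w - X s w) (fun w => X h w - X 0 w);
  levy_cadlag : {ae P, forall w, cadlag (X ^~ w)} }.

(* E[exp(i xi.Y)], by real and imaginary parts. *)
Definition char_fun (Y : Omega -> 'rV[R]_d) (xi : 'rV[R]_d) : R[i] :=
  Complex (fine 'E_P[fun w => cos (dotprod xi (Y w))])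
          (fine 'E_P[fun w => sin (dotprod xi (Y w))]).

Definition cauchy_process (X : R -> Omega -> 'rV[R]_d) : Prop :=
  levy_process X /\
  forall (t : R) (xi : 'rV[R]_d), 0 <= t -> char_fun (X t) xi = ((expR (- (t * enorm xi)))%:C)%C.

Definition semigroup (X : R -> Omega -> 'rV[R]_d) (t : R) (f : 'rV[R]_d -> R)
    (x : 'rV[R]_d) : R :=
  fine 'E_P[fun w => f (x + X t w)].

(* The graph of the generator: Af = g. *)
Definition generator (X : R -> Omega -> 'rV[R]_d) (f g : 'rV[R]_d -> R) : Prop :=
  [/\ C_infty f, C_infty g &
   supnorm (fun x => t^-1 * (semigroup X t f x - f x) - g x) @[t --> 0^'+] --> 0%E].

Definition generator_domain (X : R -> Omega -> 'rV[R]_d) : set ('rV[R]_d -> R) :=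
  [set f | exists g, generator X f g].

End LevyProcess.

(* Main.v *)
Require Import Defs.
From mathcomp Require Import all_boot all_order all_algebra.
From mathcomp Require Import all_classical all_reals all_analysis.
From mathcomp Require Import measurable_realfun ring lra complex.

(* With v(y) = |y| / (1 + ln (1 + 1/|y|)), take f(x) = v(x_j) / (1 + |x|^2).
   Since v is C^1, f belongs to C_infty^1, but v decays so slowly at 0 that it
   dominates, up to a constant, every partial sum G_n of
   sum_k 4^-k / (k + 1) * (1 - cos (4^k y)).
   As E (1 - cos (s X_t^j)) = 1 - exp (- t |s|), the quotient E G_n(X_t^j) / t is
   at least sum_(k < n) 1 / (2 (k + 1)) as soon as t <= 4^-n.  The damping factor
   1 / (1 + |x|^2) costs at most a multiple of sum_i E min(1, (X_t^i)^2), which is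
   O(t).  Hence (P_t f(0) - f(0)) / t is unbounded as t -> 0. *)

Set Implicit Arguments.
Unset Strict Implicit.
Unset Printing Implicit Defensive.
Import Order.TTheory GRing.Theory Num.Theory.
Import numFieldNormedType.Exports.
Local Open Scope classical_set_scope.
Local Open Scope ring_scope.


(** * Quadratic bounds for [1 - cos y] *)

Section Trigonometry.
Context {R : realType}.
Implicit Types y : R.

Lemma sin_eq_mul_cos y : 0 <= y -> exists2 c, 0 <= c <= y & sin y = cos c * y.
Proof.
move=> y0; have [|c] := @MVT_segment R sin cos 0 y y0.
  exact/continuous_subspaceT/continuous_sin.
by rewrite in_itv/= sin0 !subr0 => c0y ->; exists c.
Qed.

Lemma sqr_sin_le y : sin y ^+ 2 <= y ^+ 2.
Proof.
wlog y0 : y / 0 <= y.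
  move=> h; have [/h//|/ltW y0] := leP 0 y.
  by rewrite -(sqrrN y) -(sqrrN (sin y)) -sinN h// oppr_ge0.
have [c _ ->] := sin_eq_mul_cos y0.
have : cos c ^+ 2 <= 1 by rewrite cos2sin2 lerBlDr lerDl sqr_ge0.
by rewrite exprMn => h; rewrite ler_piMl// sqr_ge0.
Qed.

Lemma one_sub_cosE y : 1 - cos y = 2 * sin (y / 2) ^+ 2.
Proof.
have {1}-> : y = (y / 2) *+ 2 by rewrite -mulr_natr divfK.
by rewrite cos_mulr2n sin2cos2; ring.
Qed.

Lemma one_sub_cos_ge0 y : 0 <= 1 - cos y.
Proof. by rewrite subr_ge0 cos_le1. Qed.

Lemma one_sub_cos_le2 y : 1 - cos y <= 2.
Proof. by have := cos_geN1 y; lra. Qed.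

Lemma one_sub_cos_le y : 1 - cos y <= y ^+ 2 / 2.
Proof. by rewrite one_sub_cosE; have := sqr_sin_le (y / 2); rewrite expr_div_n; lra. Qed.

(** For [y >= 0], [1 - cos y = 2 sin(y/2)^2] and [sin(y/2) = cos c * y/2] with [0 <= c <= 1], where
    [cos c >= 1 - c^2/2 >= 1/2]. Evenness gives the rest. *)
Lemma one_sub_cos_ge y : `|y| <= 2 -> y ^+ 2 / 8 <= 1 - cos y.
Proof.
wlog y0 : y / 0 <= y.
  move=> h; have [/h//|/ltW y0] := leP 0 y.
  by rewrite -normrN -cosN -(sqrrN y) => /h; apply; rewrite oppr_ge0.
rewrite ger0_norm// => y2; rewrite one_sub_cosE.
have y20 : 0 <= y / 2 by lra.
have [c /andP[c0 cy] ->] := sin_eq_mul_cos y20.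
have h : 1 / 2 <= cos c.
  by have := one_sub_cos_le c; nra.
have : (1 / 2) ^+ 2 <= cos c ^+ 2 by nra.
rewrite exprMn => h2.
have : 0 <= (y / 2) ^+ 2 by apply: sqr_ge0.
rewrite [(y / 2)^+2]expr_div_n; nra.
Qed.

(** Halve [y] until it lies in [[-2, 2]], where [one_sub_cos_ge] applies. While [|y| > 2], the
    minimum is 1 for both [y] and [y / 2], so halving leaves the left side unchanged. *)
Lemma exists_one_sub_cos_ge y :
  exists k, Num.min 1 (y ^+ 2) <= 32 * (1 - cos (y / 2 ^+ k)).
Proof.
have [n] : exists n : nat, `|y| <= 2 ^+ n.
  exists (Num.truncn `|y|).+1; apply: ltW; apply: lt_le_trans (truncnS_gt _) _.
  by rewrite -natrX ler_nat ltnW// ltn_expl.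
have base (z : R) : `|z| <= 2 -> Num.min 1 (z ^+ 2) <= 32 * (1 - cos (z / 2 ^+ 0)).
  move=> z2; rewrite expr0 divr1; have := one_sub_cos_ge z2.
  have := sqr_ge0 z; rewrite minEle; case: ifP => //; lra.
elim: n y => [|n IHn] y hy; first by exists 0%N; apply: base; rewrite (le_trans hy)// expr0; lra.
have [y2|y2] := leP `|y| 2; first by exists 0%N; exact: base.
have [|k hk] := IHn (y / 2).
  by rewrite normf_div normr_nat ler_pdivrMr// -exprSr.
exists k.+1; rewrite (exprS 2 k) invfM mulrA; apply: le_trans hk.
have h : 4 < y ^+ 2.
  have -> : 4 = 2 ^+ 2 :> R by ring.
  by rewrite -[ltRHS]real_normK ?num_real// ltrXn2r.
rewrite !minEle; case: ifPn; case: ifPn; rewrite expr_div_n; lra.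
Qed.

End Trigonometry.


(** * The profile function and the lacunary sums it dominates *)

Section Profile.
Context {R : realType}.
Implicit Types y s : R.

(* Without the case split, 0^-1 = 0 would give the value 1 at 0 instead of the
   limit 0. *)
Definition log_rate y : R :=
  if y == 0 then 0 else (1 + ln (1 + `|y|^-1))^-1.

Definition profile y : R := `|y| * log_rate y.

(** Partial sums of a series of Weierstrass type. The factor [4^-k] cancels the frequency [4^k] that
    comes out of [1 - exp(- t 4^k)] and leaves the divergent weights [1 / (k + 1)]. *)
Definition lacunary n y : R :=
  \sum_(k < n) (4 ^+ k)^-1 / k.+1%:R * (1 - cos (4 ^+ k * y)).

Lemma log_rateN y : log_rate (- y) = log_rate y.
Proof. by rewrite /log_rate oppr_eq0 normrN. Qed.

Lemma profileN y : profile (- y) = profile y.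
Proof. by rewrite /profile normrN log_rateN. Qed.

Lemma log_rate_den_ge1 y : 1 <= 1 + ln (1 + `|y|^-1).
Proof. by rewrite lerDl ln_ge0// lerDl invr_ge0. Qed.

Lemma log_rate_ge0 y : 0 <= log_rate y.
Proof.
rewrite /log_rate; case: ifP => // _; rewrite invr_ge0.
exact: le_trans (log_rate_den_ge1 y).
Qed.

Lemma log_rate_le1 y : log_rate y <= 1.
Proof.
rewrite /log_rate; case: ifP => // _; have h := log_rate_den_ge1 y.
by rewrite invf_le1// (lt_le_trans _ h).
Qed.

Lemma profile_ge0 y : 0 <= profile y.
Proof. by rewrite mulr_ge0// log_rate_ge0. Qed.

Lemma profile_le y : profile y <= `|y|.
Proof. by rewrite ler_piMr// log_rate_le1. Qed.

Lemma profile0 : profile 0 = 0.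
Proof. by rewrite /profile normr0 mul0r. Qed.

(** For [0 < |y| < exp(-1/e)] one has [ln(1/|y|) >= 1/e], so the denominator exceeds [1/e]. This is
    what makes [profile] continuously differentiable at 0. *)
Lemma log_rate_small (e : R) : 0 < e ->
  exists2 r, 0 < r & forall y, `|y| < r -> log_rate y < e.
Proof.
move=> e0; exists (expR (- e^-1)); first exact: expR_gt0.
move=> y; rewrite /log_rate; case: ifPn => // y0 hy.
have ny : 0 < `|y| by rewrite normr_gt0.
have yV : e^-1 <= ln `|y|^-1.
  rewrite lnV ?posrE// lerNr -[leRHS]expRK ler_ln ?posrE ?expR_gt0//.
  exact: ltW.
have h : ln `|y|^-1 <= ln (1 + `|y|^-1).
  by rewrite ler_ln ?posrE ?invr_gt0// ?lerDr// addr_gt0 ?invr_gt0.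
have d1 := log_rate_den_ge1 y.
by rewrite invf_plt ?posrE//; lra.
Qed.

Lemma lacunary_ge0 n y : 0 <= lacunary n y.
Proof.
by apply: sumr_ge0 => k _; rewrite mulr_ge0 ?one_sub_cos_ge0.
Qed.

Lemma lacunary0 n : lacunary n 0 = 0.
Proof. by apply: big1 => k _; rewrite mulr0 cos0 subrr mulr0. Qed.

Lemma lacunaryN n y : lacunary n (- y) = lacunary n y.
Proof. by apply: eq_bigr => k _; rewrite mulrN cosN. Qed.

Lemma lacunary_le4 n y : lacunary n y <= 4.
Proof.
(* Each term is at most [2 * 4^-k]; the bound carries the geometric remainder so that the induction
   closes. *)
suff: lacunary n y <= 4 - 8 / 3 * (4 ^+ n)^-1.
  have : (0 : R) <= (4 ^+ n)^-1 by rewrite invr_ge0 exprn_ge0.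
  lra.
rewrite /lacunary; elim: n => [|n IHn]; first by rewrite big_ord0 expr0 invr1; lra.
rewrite big_ord_recr/= exprS invfM.
have p0 : (0 : R) <= (4 ^+ n)^-1 by rewrite invr_ge0 exprn_ge0.
have p1 : n.+1%:R^-1 <= 1 :> R by rewrite invf_le1// ler1n.
have p2 : (4 ^+ n)^-1 / n.+1%:R <= (4 ^+ n)^-1 :> R by rewrite ler_piMr.
have p3 : 0 <= (4 ^+ n)^-1 / n.+1%:R :> R by rewrite divr_ge0.
have := one_sub_cos_ge0 (4 ^+ n * y); have := one_sub_cos_le2 (4 ^+ n * y).
move: (4 ^+ n)^-1 p0 p2 p3 IHn => a; move: (a / _) => b; nra.
Qed.

(** With [psi r = r / (1 + r)], the last factor is [psi (2 s) - psi s = s / ((1 + s) (1 + 2 s))],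
    shaped for telescoping. For [s <= 1] use [1 - cos (s^2) <= s^4 / 2], for [s > 1] use
    [1 - cos (s^2) <= 2]; the second range yields the constant 36. *)
Lemma one_sub_cos_sqr_le s : 0 < s ->
  (1 - cos (s ^+ 2)) * (1 + 2 / s) <=
  36 * s ^+ 2 * (2 * s / (1 + 2 * s) - s / (1 + s)).
Proof.
move=> s0.
have -> : 2 * s / (1 + 2 * s) - s / (1 + s) = s / ((1 + s) * (1 + 2 * s)).
  by field; apply/andP; split; apply: lt0r_neq0; lra.
have -> : 1 + 2 / s = (s + 2) / s by field; exact: lt0r_neq0.
have d0 : 0 < (1 + s) * (1 + 2 * s) by nra.
rewrite !mulrA ler_pdivrMr// mulrAC ler_pdivlMr//.
have := one_sub_cos_ge0 (s ^+ 2); have := one_sub_cos_le2 (s ^+ 2).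
have := one_sub_cos_le (s ^+ 2); rewrite -exprM.
move: (1 - cos _) => c; move=> h4 h2 h0.
have [s1|s1] := leP s 1.
  apply: (@le_trans _ _ (s ^+ (2 * 2) / 2 * (s + 2) * ((1 + s) * (1 + 2 * s)))).
    by do 2!(apply: ler_wpM2r; first nra).
  have -> : 36 * s * s * s * s = s ^+ (2 * 2) / 2 * 72 by rewrite !exprS expr0; field.
  rewrite -mulrA ler_wpM2l ?divr_ge0 ?exprn_ge0//; last by nra.
  exact: ltW.
apply: (@le_trans _ _ (2 * (s + 2) * ((1 + s) * (1 + 2 * s)))).
  by do 2!(apply: ler_wpM2r; first nra).
have a1 : s + 2 <= 3 * s by lra.
have a2 : (1 + s) * (1 + 2 * s) <= 6 * s ^+ 2 by nra.
apply: (@le_trans _ _ (2 * (3 * s) * (6 * s ^+ 2))).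
  by apply: ler_pM => //; nra.
nra.
Qed.

(** If [y = s^2 / 4^k], then [1 + 1/y <= 4^k (1 + 1/s)^2], whose logarithm is at most [2 k + 2/s]
    because [ln 2 <= 1] and [ln (1 + 1/s) <= 1/s]. The resulting factor [k + 1] is absorbed by the
    weight [1 / (k + 1)] in [lacunary]. *)
Lemma log_rate_den_le k s : 0 < s ->
  1 + ln (1 + (s ^+ 2 / 4 ^+ k)^-1) <= 2 * k.+1%:R * (1 + 2 / s).
Proof.
move=> s0; have f0 : (0 : R) < 4 ^+ k by rewrite exprn_gt0.
have sV : 0 < s^-1 by rewrite invr_gt0.
have h : 1 + (s ^+ 2 / 4 ^+ k)^-1 <= 4 ^+ k * (1 + s^-1) ^+ 2.
  have f1 : (1 : R) <= 4 ^+ k by rewrite exprn_ege1//; lra.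
  rewrite invf_div -exprVn; nra.
have l1 : ln (1 + (s ^+ 2 / 4 ^+ k)^-1) <= ln (4 ^+ k * (1 + s^-1) ^+ 2).
  rewrite ler_ln// posrE; last by rewrite mulr_gt0// exprn_gt0; lra.
  by rewrite addr_gt0// invr_gt0 divr_gt0// exprn_gt0.
move: l1; rewrite lnM ?posrE ?exprn_gt0//; last by lra.
rewrite !lnXn; [|lra|lra].
have -> : (4 : R) = 2 ^+ 2 by ring.
rewrite lnXn//.
have l2 : ln (2 : R) <= 1 by have := @le_ln1Dx R 1; rewrite -[1 + 1]/2; apply; lra.
have l3 : ln (1 + s^-1) <= s^-1 by apply: le_ln1Dx; lra.
rewrite -(natr1 k) -[ln 2 *+ 2]mulr_natl -[_ *+ k]mulr_natl -[ln _ *+ 2]mulr_natl => l1.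
have k0 : 0 <= (k%:R : R) by rewrite ler0n.
have l4 : k%:R * ln (2 : R) <= k%:R by rewrite ler_piMr.
have l5 : 0 <= k%:R * s^-1 by rewrite mulr_ge0// ltW.
lra.
Qed.

(* With s_k = 2^k sqrt |y|, the k-th term is at most a multiple of
   psi s_(k+1) - psi s_k for psi s = s / (1 + s), and the sum telescopes. *)
Lemma lacunary_le_profile n y : lacunary n y <= 72 * profile y.
Proof.
wlog y0 : y / 0 < y.
  move=> h; have [/h//|y0|<-] := ltgtP 0 y; last by rewrite lacunary0 profile0 mulr0.
  by rewrite -lacunaryN -profileN h// oppr_gt0.
rewrite /profile /log_rate gt_eqF// gtr0_norm//.
have L0 : 0 < 1 + ln (1 + y^-1) by have := log_rate_den_ge1 y; rewrite gtr0_norm//; lra.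
rewrite mulrA ler_pdivlMr// /lacunary mulr_suml.
pose s k : R := 2 ^+ k * Num.sqrt y.
have s0 k : 0 < s k by rewrite mulr_gt0 ?exprn_gt0 ?sqrtr_gt0.
have sE k : s k ^+ 2 = 4 ^+ k * y.
  by rewrite exprMn sqr_sqrtr ?ltW// -exprM mulnC exprM; congr (_ ^+ k * _); ring.
have sS k : s k.+1 = 2 * s k by rewrite /s exprS mulrA.
pose psi k := s k / (1 + s k).
apply: (@le_trans _ _ (\sum_(k < n) 72 * y * (psi k.+1 - psi k))).
  apply: ler_sum => k _.
  have := @one_sub_cos_sqr_le _ (s0 k); have := log_rate_den_le k (s0 k).
  have f0 : (0 : R) < 4 ^+ k by rewrite exprn_gt0.
  rewrite sE mulrAC divff ?gt_eqF// mul1r /psi sS.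
  set D := _ - s k / _ => hL hc.
  have k0 : 0 < (k.+1%:R : R) by rewrite ltr0n.
  rewrite (_ : _ * _ * _ * _ =
    ((1 - cos (4 ^+ k * y)) * (1 + ln (1 + y^-1))) / (4 ^+ k * k.+1%:R)); last first.
    by rewrite invfM; ring.
  rewrite ler_pdivrMr ?mulr_gt0//.
  (* The logarithm contributes [2 (k + 1)] and the cosine estimate 36; once [k + 1] cancels, 72
     remains. *)
  apply: (@le_trans _ _ (2 * k.+1%:R * ((1 - cos (4 ^+ k * y)) * (1 + 2 / s k)))).
    by have := one_sub_cos_ge0 (4 ^+ k * y); nra.
  rewrite (_ : 72 * y * D * _ = 2 * k.+1%:R * (36 * (4 ^+ k * y) * D)); last by ring.
  by rewrite ler_wpM2l// mulr_ge0.
rewrite -mulr_sumr -(big_mkord predT (fun k => psi k.+1 - psi k)).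
rewrite telescope_sumr// ler_piMr//; first by rewrite mulr_ge0// ltW.
have : 0 <= psi 0%N by rewrite divr_ge0// ?addr_ge0// ltW.
have : psi n <= 1 by rewrite ler_pdivrMr ?addr_gt0// mul1r lerDr.
lra.
Qed.

End Profile.


(** * Continuous differentiability of the profile *)

Section ProfileC1.
Context {R : realType}.
Implicit Types y : R.

(** For [y > 0] this is [L + y L'] with [L = log_rate] and [L' = L^2 / (y (1 + y))]; the sign makes
    it odd and gives 0 at the origin. *)
Definition dprofile y : R :=
  Num.sg y * (log_rate y + log_rate y ^+ 2 / (1 + `|y|)).

Lemma dprofileN y : dprofile (- y) = - dprofile y.
Proof. by rewrite /dprofile log_rateN normrN sgrN mulNr. Qed.

Lemma dprofile_le y : `|dprofile y| <= 2 * log_rate y.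
Proof.
have := log_rate_ge0 y; have := log_rate_le1 y => h1 h0.
have [->|y0] := eqVneq y 0; first by rewrite /dprofile sgr0 mul0r normr0 mulr_ge0 ?log_rate_ge0.
rewrite normrM normr_sg y0 mul1r ger0_norm; last first.
  by rewrite addr_ge0// divr_ge0 ?sqr_ge0// addr_ge0.
suff : log_rate y ^+ 2 / (1 + `|y|) <= log_rate y by lra.
rewrite ler_pdivrMr; last by rewrite ltr_pwDl.
have := normr_ge0 y; nra.
Qed.

Lemma near_log_rate y : 0 < y ->
  \forall z \near y, (1 + ln (1 + z^-1))^-1 = log_rate z.
Proof.
move=> y0; near=> z.
have z0 : 0 < z by near: z; exact: lt_nbhsr.
by rewrite /log_rate gt_eqF// gtr0_norm.
Unshelve. all: by end_near. Qed.

Lemma is_derive_log_rate y : 0 < y ->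
  is_derive y 1 log_rate (log_rate y ^+ 2 / (y * (1 + y))).
Proof.
move=> y0; apply: (near_eq_is_derive (near_log_rate y0)).
have yV : 0 < 1 + y^-1 by rewrite addr_gt0// invr_gt0.
have yn : y != 0 by rewrite gt_eqF.
have d1 : is_derive y 1 (fun z : R => 1 + z^-1) (- y ^- 2).
  have dV := is_deriveV yn (is_derive_id y (1 : R)).
  apply: (is_derive_eq (is_deriveD (is_derive_cst (1 : R) y 1) dV)).
  by rewrite add0r /GRing.scale/= mulr1.
have d2 : is_derive y 1 (fun z : R => 1 + ln (1 + z^-1)) (- (y * (1 + y))^-1).
  have dln := @is_derive1_comp R (@ln R) (fun z => 1 + z^-1) _ _ _ (is_derive1_ln yV) d1.
  apply: (is_derive_eq (is_deriveD (is_derive_cst (1 : R) y 1) dln)).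
  by rewrite add0r; field; rewrite !gt_eqF//=; lra.
have d0 : 1 + ln (1 + y^-1) != 0.
  by have := log_rate_den_ge1 y; rewrite gtr0_norm// => h; rewrite gt_eqF//; lra.
apply: (is_derive_eq (is_deriveV (f := fun z : R => 1 + ln (1 + z^-1)) d0 d2)).
rewrite /log_rate gt_eqF// gtr0_norm// /GRing.scale/= exprVn.
by rewrite mulrNN.
Qed.

(** The product rule handles [y > 0] and evenness handles [y < 0]. At 0 the difference quotient has
    absolute value [log_rate h], which tends to 0. *)
Lemma is_derive_profile y : is_derive y 1 profile (dprofile y).
Proof.
have pos (z : R) : 0 < z -> is_derive z 1 profile (dprofile z).
  move=> z0; apply: (@near_eq_is_derive _ _ _ (fun y => y * log_rate y)).
    near=> w; rewrite /profile ger0_norm//; apply: ltW.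
    by near: w; exact: lt_nbhsr.
  apply: (is_derive_eq (is_deriveM (is_derive_id z (1 : R)) (is_derive_log_rate z0))).
  rewrite /dprofile gtr0_sg// gtr0_norm// /GRing.scale/=.
  by field; rewrite !gt_eqF//=; lra.
have [y0|y0|<-] := ltgtP 0 y; first exact: pos.
  have -> : profile = profile \o (-%R : R -> R).
    by apply/funext => z; rewrite /= profileN.
  apply: is_derive_eq.
    by apply: (@is_derive1_comp R profile -%R y); apply: pos; rewrite oppr_gt0.
  by rewrite dprofileN mulrNN mulr1.
have dp0 : dprofile 0 = 0 by rewrite /dprofile sgr0 mul0r.
have h : h^-1 *: (profile (h *: 1 + 0) - profile 0) @[h --> (0 : R)^'] --> (0 : R).
  apply/cvgrPdist_lt => e e0; have [r r0 hr] := log_rate_small e0.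
  near=> h; rewrite sub0r normrN profile0 subr0 addr0 /GRing.scale/= mulr1.
  have h0 : h != 0 by near: h; exact: nbhs_dnbhs_neq.
  rewrite /profile mulrA normrM normrM normrV ?unitfE// normr_id mulVf ?normr_eq0//.
  rewrite mul1r ger0_norm ?log_rate_ge0//; apply: hr.
  near: h; exact: dnbhs0_lt.
rewrite dp0; apply: DeriveDef; first by apply/cvg_ex; exists 0.
exact: cvg_lim h.
Unshelve. all: by end_near. Qed.

(** Away from 0 the explicit formula and oddness suffice; at 0 use
    [|dprofile h| <= 2 * log_rate h]. *)
Lemma continuous_dprofile : continuous dprofile.
Proof.
have pos (z : R) : 0 < z -> {for z, continuous dprofile}.
  move=> z0.
  have c1 : {for z, continuous log_rate}.
    by apply: differentiable_continuous; apply/derivable1_diffP; case: (is_derive_log_rate z0).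
  have c2 : log_rate w + log_rate w ^+ 2 / (1 + w) @[w --> z] --> dprofile z.
    rewrite /dprofile gtr0_sg// mul1r gtr0_norm//.
    apply: cvgD => //; apply: cvgM; first exact: (cvgM c1 c1).
    apply: cvgV; first by rewrite gt_eqF//; lra.
    by apply: cvgD; [exact: cvg_cst|exact: cvg_id].
  apply: cvg_trans c2; apply: near_eq_cvg; near=> w.
  have w0 : 0 < w by near: w; exact: lt_nbhsr.
  by rewrite /dprofile gtr0_sg// mul1r gtr0_norm.
move=> y; have [y0|y0|<-] := ltgtP 0 y; first exact: pos.
  have -> : dprofile = (-%R : R -> R) \o (dprofile \o (-%R : R -> R)).
    by apply/funext => z /=; rewrite dprofileN opprK.
  apply: continuous_comp; last exact: opp_continuous.
  apply: continuous_comp; first exact: opp_continuous.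
  by apply: pos; rewrite oppr_gt0.
have dp0 : dprofile 0 = 0 by rewrite /dprofile sgr0 mul0r.
rewrite /continuous_at dp0; apply/cvgrPdist_lt => e e0.
have e20 : 0 < e / 2 by lra.
have [r r0 hr] := log_rate_small e20; near=> h.
rewrite sub0r normrN; apply: le_lt_trans (dprofile_le h) _.
suff : log_rate h < e / 2 by lra.
apply: hr; near: h; apply: (@nbhs0_lt R R r r0).
Unshelve. all: by end_near. Qed.

End ProfileC1.


(** * Euclidean norm and coordinates *)

Section Euclidean.
Context {R : realType} {d : nat}.
Implicit Types (x : 'rV[R]_d) (i : 'I_d).

(** A sum of products of coordinate functions is the shape to which the sum and product rules of
    differentiation apply. *)
Lemma dotprodE : (fun x => dotprod x x) =
  \sum_(i < d) ((fun x => x ord0 i) * (fun x => x ord0 i)).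
Proof. by apply/funext => x; rewrite /dotprod fct_sumE. Qed.

Lemma continuous_dotprod : continuous (fun x => dotprod x x).
Proof.
move=> x; rewrite dotprodE; apply: differentiable_continuous.
by apply: differentiable_sum => i; apply: differentiableM; exact: differentiable_coord.
Qed.

Lemma dotprod_ge0 x : 0 <= dotprod x x.
Proof. by apply: sumr_ge0 => i _; rewrite -expr2 sqr_ge0. Qed.

Lemma coord_sqr_le x i : x ord0 i ^+ 2 <= dotprod x x.
Proof.
rewrite /dotprod (bigD1 i)//= -expr2 lerDl sumr_ge0// => j _.
by rewrite -expr2 sqr_ge0.
Qed.

Lemma enorm_sqr x : enorm x ^+ 2 = dotprod x x.
Proof. by rewrite sqr_sqrtr// dotprod_ge0. Qed.

Lemma dotprod_basis_vec (s : R) i x : dotprod (s *: basis_vec i) x = s * x ord0 i.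
Proof.
rewrite /dotprod (bigD1 i)//= !mxE !eqxx mulr1 big1 ?addr0// => j ji.
by rewrite !mxE eqxx (negbTE ji) mulr0 mul0r.
Qed.

Lemma enorm_basis_vec (s : R) i : enorm (s *: basis_vec i) = `|s|.
Proof. by rewrite /enorm dotprod_basis_vec !mxE !eqxx mulr1 -expr2 sqrtr_sqr. Qed.

End Euclidean.

(** * Expectations from the characteristic function *)

Section RandomVector.
Context {R : realType} {d : nat} {disp : measure_display}
  {Omega : measurableType disp} (P : probability Omega R).

Lemma measurable_continuous_comp (Y : Omega -> 'rV[R]_d) (g : 'rV[R]_d -> R) :
  random_vector Y -> continuous g -> measurable_fun [set: Omega] (g \o Y).
Proof.
move=> mY cg; apply: (measurability _ (RGenOpens.measurableE R)).
move=> _ [_ [a [b ->]] <-]; rewrite setTI comp_preimage.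
have -> : Y @^-1` (g @^-1` `]a, b[) = [set: Omega] `&` Y @^-1` (g @^-1` `]a, b[).
  by rewrite setTI.
apply: mY => //; apply: sub_sigma_algebra => /=.
by apply: open_comp => //; exact: itv_open.
Qed.

Context (X : R -> Omega -> 'rV[R]_d) (hX : cauchy_process P X).

(** Take real parts of the characteristic function at [s e_i], a vector of Euclidean norm [|s|]. *)
Lemma integral_one_sub_cos (t s : R) i : 0 <= t ->
  (\int[P]_w (1 - cos (s * X t w ord0 i))%:E = (1 - expR (- (t * `|s|)))%:E)%E.
Proof.
move=> t0; have [lX cX] := hX.
have cc : continuous (fun x : 'rV[R]_d => cos (s * x ord0 i)).
  move=> x; have c1 : s * z ord0 i @[z --> x] --> s * x ord0 i.
    exact: (differentiable_continuous (differentiableZ s (differentiable_coord x ord0 i))).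
  apply: cvg_comp c1 _; exact: continuous_cos.
have mc := measurable_continuous_comp (levy_random_vector lX t0) cc.
have ic : P.-integrable [set: Omega] (EFin \o (fun w => cos (s * X t w ord0 i))).
  apply: measurable_bounded_integrable => //.
    by apply: (@le_lt_trans _ _ 1%E); [exact: probability_le1|exact: ltry].
  exists 1; split; first exact: num_real.
  by move=> M M1 w _ /=; apply: le_trans (cos_max _) (ltW M1).
have /(congr1 (@complex.Re R)) /= := cX t (s *: basis_vec i) t0.
rewrite enorm_basis_vec => hE.
have -> : (\int[P]_w (1 - cos (s * X t w ord0 i))%:E =
    \int[P]_w ((cst 1%:E w) - (EFin \o (fun w => cos (s * X t w ord0 i))) w))%E.
  by apply: eq_integral.
rewrite integralB//; last exact: finite_measure_integrable_cst.
rewrite integral_cst//= probability_setT mule1 EFinB; congr (_ - _)%E.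
have e : ('E_P[fun w => cos (dotprod (s *: basis_vec i) (X t w))] =
    \int[P]_w (EFin \o (fun w => cos (s * X t w ord0 i))) w)%E.
  by rewrite unlock; apply: eq_integral => w _; rewrite dotprod_basis_vec.
(* Integrability makes the expectation finite, so [fine] loses nothing. *)
by rewrite -hE e fineK// integrable_fin_num.
Qed.

End RandomVector.


(** * The damped test function and its decay *)

Section TestFunction.
Context {R : realType} {d : nat}.
Implicit Types (x : 'rV[R]_d) (i j : 'I_d).

(** Along [e_i] the difference quotient is that of [u] when [i = j] and vanishes identically
    otherwise. *)
Lemma is_derive_comp_coord (u : R -> R) (du : R) i j x :
  is_derive (x ord0 j) 1 u du ->
  is_derive x (basis_vec i) (fun y => u (y ord0 j)) ((i == j)%:R * du).
Proof.
have E (h : R) : (h *: basis_vec i + x) ord0 j = h * (i == j)%:R + x ord0 j.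
  by rewrite !mxE eqxx/= eq_sym.
move=> [hp hd]; rewrite /derivable in hp; rewrite /derive in hd.
have [ij|ij] := eqVneq i j.
  have Q : (fun h : R => h^-1 *: (u ((h *: basis_vec i + x) ord0 j) - u (x ord0 j)))
     = (fun h : R => h^-1 *: (u (h *: 1 + x ord0 j) - u (x ord0 j))).
    by apply/funext => h; rewrite E ij eqxx.
  by apply: DeriveDef; rewrite /derivable /derive /= Q// hd mul1r.
have Q : (fun h : R => h^-1 *: (u ((h *: basis_vec i + x) ord0 j) - u (x ord0 j)))
    = cst (0 : R).
  by apply/funext => h; rewrite E (negbTE ij) mulr0 add0r subrr scaler0.
apply: DeriveDef; rewrite /derivable /derive /= Q ?mul0r; first exact: is_cvg_cst.
exact: lim_cst.
Qed.

Lemma continuous_comp_coord (u : R -> R) j :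
  continuous u -> continuous (fun x => u (x ord0 j)).
Proof.
move=> cu x; have c1 : z ord0 j @[z --> x] --> x ord0 j by exact: coord_continuous.
exact: cvg_comp c1 (cu _).
Qed.

Lemma is_derive_one_add_dotprod i x :
  is_derive x (basis_vec i) (fun y => 1 + dotprod y y) (2 * x ord0 i).
Proof.
have h j : is_derive x (basis_vec i) ((fun x => x ord0 j) * (fun x => x ord0 j))
    ((i == j)%:R * (2 * x ord0 j)).
  apply: (@is_derive_comp_coord (fun z => z * z)).
  apply: (is_derive_eq (is_deriveM (is_derive_id _ (1 : R)) (is_derive_id _ (1 : R)))).
  by rewrite /GRing.scale/=; ring.
have := is_deriveD (is_derive_cst (1 : R) x (basis_vec i)) (is_derive_sum h).
rewrite -dotprodE => hD; apply: (is_derive_eq hD).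
by rewrite add0r (bigD1 i)//= eqxx mul1r big1 ?addr0// => j /negbTE;
  rewrite eq_sym => ->; rewrite mul0r.
Qed.

Lemma one_add_dotprod_gt0 x : 0 < 1 + dotprod x x.
Proof. by rewrite ltr_pwDl// dotprod_ge0. Qed.

Definition test_fun j x : R := profile (x ord0 j) * (1 + dotprod x x)^-1.

Definition dtest_fun j i x : R :=
  (i == j)%:R * dprofile (x ord0 j) * (1 + dotprod x x)^-1 -
  2 * x ord0 i * profile (x ord0 j) * (1 + dotprod x x)^-1 * (1 + dotprod x x)^-1.

Lemma is_derive_test_fun j i x :
  is_derive x (basis_vec i) (test_fun j) (dtest_fun j i x).
Proof.
have hp := is_derive_comp_coord i (is_derive_profile (x ord0 j)).
have [dD eD] := is_derive_one_add_dotprod i x.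
have D0 : 1 + dotprod x x != 0 by rewrite gt_eqF// one_add_dotprod_gt0.
have hV : is_derive x (basis_vec i) (fun y => (1 + dotprod y y)^-1)
    (- (1 + dotprod x x) ^- 2 * (2 * x ord0 i)).
  by apply: DeriveDef; [exact: derivableV|rewrite deriveV// eD].
apply: (is_derive_eq (is_deriveM hp hV)).
by rewrite /dtest_fun /GRing.scale/=; field.
Qed.

Lemma continuous_profile : continuous (@profile R).
Proof.
move=> y; apply: differentiable_continuous; apply/derivable1_diffP.
by case: (is_derive_profile y).
Qed.

Lemma continuous_one_add_dotprodV : continuous (fun x => (1 + dotprod x x)^-1).
Proof.
move=> x; have c1 : {for dotprod x x, continuous (fun y : R => (1 + y)^-1)}.
  apply: cvgV; first by rewrite gt_eqF// one_add_dotprod_gt0.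
  by apply: cvgD; [exact: cvg_cst|exact: cvg_id].
exact: cvg_comp (@continuous_dotprod R d x) c1.
Qed.

Lemma continuous_test_fun j : continuous (test_fun j).
Proof.
move=> x.
have cp : {for x, continuous (fun y : 'rV[R]_d => profile (y ord0 j))}.
  exact: continuous_comp_coord continuous_profile x.
exact: (continuousM cp (@continuous_one_add_dotprodV x)).
Qed.

Lemma continuous_dtest_fun j i : continuous (dtest_fun j i).
Proof.
move=> x; have cV := @continuous_one_add_dotprodV x.
have cp : {for x, continuous (fun y : 'rV[R]_d => profile (y ord0 j))}.
  exact: continuous_comp_coord continuous_profile x.
have cd : {for x, continuous (fun y : 'rV[R]_d => dprofile (y ord0 j))}.
  exact: continuous_comp_coord continuous_dprofile x.
have ci : {for x, continuous (fun z : 'rV[R]_d => 2 * z ord0 i)}.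
  exact: (differentiable_continuous (differentiableZ 2 (differentiable_coord x ord0 i))).
have c1 :=
  continuousM (continuousM (differentiable_continuous
  (differentiable_cst ((i == j)%:R : R) x)) cd) cV.
exact: (continuousB c1 (continuousM (continuousM (continuousM ci cp) cV) cV)).
Qed.

Lemma vanishes_at_infinity_le (g : 'rV[R]_d -> R) (C : R) :
  (forall x, `|g x| * enorm x <= C) -> vanishes_at_infinity g.
Proof.
(* Using [|C|] keeps the radius nonnegative, so that [enorm x > 0] and can be cancelled. *)
move=> h e e0; exists (`|C| / e) => x; rewrite ltr_pdivrMr// => hx.
have x0 : 0 < enorm x.
  by rewrite -(pmulr_lgt0 _ e0); exact: le_lt_trans hx.
rewrite -(ltr_pM2r x0); apply: le_lt_trans (h x) _.
by apply: le_lt_trans (ler_norm _) _; rewrite mulrC.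
Qed.

Lemma abs_coord_le x i : `|x ord0 i| <= enorm x.
Proof.
rewrite -(@ler_pXn2r _ 2)// ?nnegrE ?sqrtr_ge0//.
by rewrite real_normK ?num_real// enorm_sqr coord_sqr_le.
Qed.

(** With [n = enorm x], coordinates and profile are at most [n]. Hence the function is bounded by
    [n / (1 + n^2)] and its partial derivatives by [2 / (1 + n^2) + 2 n^2 / (1 + n^2)^2], both
    [O(1/n)]. *)
Lemma C1_infty_test_fun j : C1_infty (test_fun j).
Proof.
have n0 x : 0 <= enorm x by exact: sqrtr_ge0.
have V0 x : 0 < (1 + dotprod x x)^-1 by rewrite invr_gt0 one_add_dotprod_gt0.
have pl x : `|profile (x ord0 j)| <= enorm x.
  by rewrite ger0_norm ?profile_ge0// (le_trans (profile_le _))// abs_coord_le.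
split; first split; first exact: continuous_test_fun.
  apply: (@vanishes_at_infinity_le _ 1) => x.
  rewrite normrM (ger0_norm (ltW (V0 x))) mulrAC ler_pdivrMr ?one_add_dotprod_gt0//.
  by rewrite mul1r -enorm_sqr; have := pl x; have := n0 x; nra.
move=> i; split; first by move=> x; case: (is_derive_test_fun j i x).
have -> : (fun x => 'D_(basis_vec i) (test_fun j) x) = dtest_fun j i.
  by apply/funext => x; case: (is_derive_test_fun j i x).
split; first exact: continuous_dtest_fun.
apply: (@vanishes_at_infinity_le _ 3) => x.
have dl : `|(i == j)%:R * dprofile (x ord0 j)| <= 2.
  rewrite normrM; apply: (@le_trans _ _ (1 * 2)); last by rewrite mul1r.
  apply: ler_pM => //; first by case: (i == j); rewrite ?normr1 ?normr0.
  by apply: le_trans (dprofile_le _) _; have := log_rate_le1 (x ord0 j); lra.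
have D0 := one_add_dotprod_gt0 x.
have -> : 3 = 1 + 2 :> R by ring.
apply: (@le_trans _ _ ((2 * (1 + dotprod x x)^-1 +
   2 * enorm x * enorm x * (1 + dotprod x x)^-1 * (1 + dotprod x x)^-1) * enorm x)).
  apply: ler_wpM2r => //.
  rewrite /dtest_fun; move: (_ * dprofile _) dl (profile _) (pl x) => a dl p hp.
  apply: le_trans (ler_normB _ _) _.
  rewrite !normrM (ger0_norm (ltW (V0 x))) normr_nat.
  apply: lerD; first by apply: ler_wpM2r; [exact: ltW|].
  do 2!(apply: ler_wpM2r; first exact: ltW).
  by apply: ler_pM => //; rewrite ler_pM2l ?abs_coord_le.
move: D0 (n0 x); rewrite -enorm_sqr; move: (enorm x) => n D0 n0'.
have -> : (2 * (1 + n ^+ 2)^-1 + 2 * n * n * (1 + n ^+ 2)^-1 * (1 + n ^+ 2)^-1) * n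
  = (2 * n * (1 + n ^+ 2) + 2 * n ^+ 3) / (1 + n ^+ 2) ^+ 2.
  by field; rewrite gt_eqF.
rewrite ler_pdivrMr ?exprn_gt0//.
have := sqr_ge0 (n - 1); rewrite !exprS expr0; nra.
Qed.

Lemma test_fun_ge0 j x : 0 <= test_fun j x.
Proof. by rewrite mulr_ge0 ?profile_ge0// invr_ge0 ltW// one_add_dotprod_gt0. Qed.

Lemma test_fun_le1 j x : test_fun j x <= 1.
Proof.
rewrite ler_pdivrMr ?one_add_dotprod_gt0// mul1r.
apply: le_trans (profile_le _) _; have := coord_sqr_le x j.
rewrite -[_ ^+ 2]real_normK ?num_real//.
have := sqr_ge0 (`|x ord0 j| - 1); nra.
Qed.

Lemma test_fun0 j : test_fun j 0 = 0.
Proof. by rewrite /test_fun mxE profile0 mul0r. Qed.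

(** Split 1 as [1 / (1 + |x|^2) + |x|^2 / (1 + |x|^2)]. The first share is bounded through
    [profile], the second through [lacunary <= 4] and [x_i^2 / (1 + |x|^2) <= min(1, x_i^2)]. *)
Lemma lacunary_le_test_fun n j x : lacunary n (x ord0 j) <=
  72 * test_fun j x + 4 * \sum_(i < d) Num.min 1 (x ord0 i ^+ 2).
Proof.
have D0 := one_add_dotprod_gt0 x.
have hq : dotprod x x / (1 + dotprod x x) <= \sum_(i < d) Num.min 1 (x ord0 i ^+ 2).
  rewrite {1}/dotprod mulr_suml; apply: ler_sum => i _.
  rewrite -expr2 ler_pdivrMr// minEle; have := coord_sqr_le x i.
  have := sqr_ge0 (x ord0 i); case: ifPn; nra.
have h1 := lacunary_le_profile n (x ord0 j).
have h2 := lacunary_le4 n (x ord0 j); have h0 := lacunary_ge0 n (x ord0 j).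
have -> : lacunary n (x ord0 j) = lacunary n (x ord0 j) / (1 + dotprod x x) +
    lacunary n (x ord0 j) * (dotprod x x / (1 + dotprod x x)).
  by field; rewrite gt_eqF.
apply: lerD; first by rewrite mulrA ler_wpM2r// invr_ge0 ltW.
by apply: ler_pM => //; rewrite divr_ge0 ?dotprod_ge0// ltW.
Qed.

End TestFunction.


(** * Small-time estimates for the Cauchy process *)

Section CauchyEstimates.
Context {R : realType} {d : nat} {disp : measure_display}
  {Omega : measurableType disp} (P : probability Omega R)
  (X : R -> Omega -> 'rV[R]_d) (hX : cauchy_process P X).

Lemma measurable_cauchy_comp (t : R) (g : 'rV[R]_d -> R) : 0 <= t ->
  continuous g -> measurable_fun [set: Omega] (fun w => g (X t w)).
Proof.
move=> t0; have [lX _] := hX.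
exact: measurable_continuous_comp (levy_random_vector lX t0).
Qed.

Lemma measurable_one_sub_cos (t s : R) i : 0 <= t ->
  measurable_fun [set: Omega] (fun w => 1 - cos (s * X t w ord0 i)).
Proof.
move=> t0; apply: (@measurable_cauchy_comp t (fun x => 1 - cos (s * x ord0 i))) => //.
apply: (@continuous_comp_coord _ _ (fun y => 1 - cos (s * y))) => y.
apply: cvgB; first exact: cvg_cst.
apply: continuous_comp; last exact: continuous_cos.
by apply: cvgM; [exact: cvg_cst|exact: cvg_id].
Qed.

Lemma integral_scaled_one_sub_cos (c t s : R) i : 0 <= t -> 0 <= c ->
  (\int[P]_w (c * (1 - cos (s * X t w ord0 i)))%:E =
   (c * (1 - expR (- (t * `|s|))))%:E)%E.
Proof.
move=> t0 c0; under eq_integral do rewrite EFinM.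
rewrite ge0_integralZl_EFin//.
- by rewrite (integral_one_sub_cos hX)// EFinM.
- by apply/measurable_EFinP; exact: measurable_one_sub_cos.
Qed.

Lemma one_sub_expRN_le (u : R) : 1 - expR (- u) <= u.
Proof. by have := expR_ge1Dx (- u); lra. Qed.

(** From [exp u >= 1 + u] and [(1 - u/2) (1 + u) >= 1] on [[0, 1]]. *)
Lemma one_sub_expRN_ge (u : R) : 0 <= u <= 1 -> u / 2 <= 1 - expR (- u).
Proof.
move=> /andP[u0 u1]; rewrite expRN lerBrDr -lerBrDl.
have h := expR_ge1Dx u; have e0 := expR_gt0 u.
rewrite -[leLHS]mul1r ler_pdivrMr//.
have : 0 <= 1 - u / 2 by lra.
nra.
Qed.

(* Every y satisfies min(1, y^2) <= 32 (1 - cos (2^-k y)) for some k, and the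
   series of the expectations is dominated by a geometric one. *)
Lemma integral_min_sqr_le (t : R) i : 0 <= t ->
  (\int[P]_w (Num.min 1 (X t w ord0 i ^+ 2))%:E <= (64 * t)%:E)%E.
Proof.
move=> t0.
pose f k w := (32 * (1 - cos ((2 ^+ k)^-1 * X t w ord0 i)))%:E.
have f0 k w : (0 <= f k w)%E by rewrite lee_fin mulr_ge0 ?one_sub_cos_ge0.
have mf k : measurable_fun [set: Omega] (f k).
  by apply/measurable_EFinP; apply: measurable_funM => //; exact: measurable_one_sub_cos.
apply: (@le_trans _ _ (\int[P]_w \sum_(k <oo) f k w)%E).
  apply: ge0_le_integral => //.
  - by move=> w _; rewrite lee_fin le_min ler01 sqr_ge0.
  - apply/measurable_EFinP.
    apply: (@measurable_minr _ _ _ _ (cst 1) (fun w => X t w ord0 i ^+ 2)) => //.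
    apply: (@measurable_cauchy_comp t (fun x => x ord0 i ^+ 2)) => //.
    apply: (@continuous_comp_coord _ _ (fun y => y ^+ 2)).
    exact: exprn_continuous.
  - exact: ge0_emeasurable_sum.
  move=> w _; have [k hk] := exists_one_sub_cos_ge (X t w ord0 i).
  (* A partial sum of [k + 1] terms is the first to contain the index [k]. *)
  apply: le_trans (nneseries_lim_ge k.+1 _) => //.
  rewrite big_nat_recr//= -[leLHS]add0e; apply: leeD; first exact: sume_ge0.
  by rewrite lee_fin mulrC [X in cos X]mulrC mulrC.
(* Integral and nonnegative series commute, so it suffices to bound the partial sums of the
   expectations. *)
rewrite integral_nneseries//; apply: lime_le.
  by apply: is_cvg_nneseries => n _ _; exact: integral_ge0.
apply: nearW => n; rewrite big_mkord.
apply: (@le_trans _ _ (\sum_(k < n) (32 * t * (2 ^+ k)^-1)%:E)%E).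
  apply: lee_sum => k _; rewrite integral_scaled_one_sub_cos// lee_fin -mulrA.
  rewrite ler_wpM2l// (le_trans (one_sub_expRN_le _))// ger0_norm//.
rewrite sumEFin lee_fin -mulr_sumr.
(* The remainder is kept for the induction; the limit 2 turns [32 t] into [64 t]. *)
suff : \sum_(k < n) (2 ^+ k)^-1 <= 2 - (2 ^+ n)^-1 * 2 :> R.
  have : 0 <= (2 ^+ n)^-1 :> R by rewrite invr_ge0 exprn_ge0.
  nra.
elim: n => [|n IHn]; first by rewrite big_ord0 expr0; lra.
by rewrite big_ord_recr/= exprS invfM; lra.
Qed.

(** Integrate [lacunary_le_test_fun] at [X t]: the left side is the expectation of the lacunary sum,
    and the [d] truncated squares cost [4 * 64 t] each. *)
Lemma semigroup_test_fun_ge n j (t : R) : 0 <= t ->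
  \sum_(k < n) (4 ^+ k)^-1 / k.+1%:R * (1 - expR (- (t * 4 ^+ k))) <=
  72 * semigroup P X t (test_fun j) 0 + 256 * d%:R * t.
Proof.
move=> t0.
have mT : measurable_fun [set: Omega] (fun w => test_fun j (X t w)).
  exact: (measurable_cauchy_comp t0 (@continuous_test_fun R d j)).
(* Since the test function lies in [[0, 1]], its expectation is finite and the [fine] in [semigroup]
   can be undone. *)
have iT : P.-integrable [set: Omega] (EFin \o (fun w => test_fun j (X t w))).
  apply: measurable_bounded_integrable => //.
    by apply: (@le_lt_trans _ _ 1%E); [exact: probability_le1|exact: ltry].
  exists 1; split; first exact: num_real.
  move=> M M1 w _ /=; rewrite ger0_norm ?test_fun_ge0//.
  exact: le_trans (test_fun_le1 _ _) (ltW M1).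
have sE : semigroup P X t (test_fun j) 0 =
    fine (\int[P]_w (EFin \o (fun w => test_fun j (X t w))) w).
  by rewrite /semigroup unlock; congr fine; apply: eq_integral => w _; rewrite add0r.
have mq i : measurable_fun [set: Omega] (fun w => Num.min 1 (X t w ord0 i ^+ 2)).
  apply: (@measurable_minr _ _ _ _ (cst 1) (fun w => X t w ord0 i ^+ 2)) => //.
  apply: (@measurable_cauchy_comp t (fun x => x ord0 i ^+ 2)) => //.
  by apply: (@continuous_comp_coord _ _ (fun y => y ^+ 2)); exact: exprn_continuous.
have c0 k : 0 <= (4 ^+ k)^-1 / k.+1%:R :> R by rewrite divr_ge0.
have q0 i w : (0 <= (Num.min 1 (X t w ord0 i ^+ 2))%:E)%E.
  by rewrite lee_fin le_min ler01 sqr_ge0.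
rewrite -lee_fin -sumEFin.
apply: (@le_trans _ _ (\int[P]_w (lacunary n (X t w ord0 j))%:E)%E).
  under [leRHS]eq_integral do rewrite /lacunary -sumEFin.
  rewrite ge0_integral_sum//.
  - apply: lee_sum => k _; rewrite integral_scaled_one_sub_cos//.
    by rewrite (@ger0_norm _ (4 ^+ k)).
  - move=> k; apply/measurable_EFinP; apply: measurable_funM => //.
    exact: measurable_one_sub_cos.
apply: (@le_trans _ _ (\int[P]_w (72%:E * (EFin \o (fun w => test_fun j (X t w))) w +
   4%:E * \sum_(i < d) (Num.min 1 (X t w ord0 i ^+ 2))%:E))%E).
  apply: ge0_le_integral => //.
  - by move=> w _; rewrite lee_fin lacunary_ge0.
  - apply/measurable_EFinP; apply: measurable_sum => k.
    by apply: measurable_funM => //; exact: measurable_one_sub_cos.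
  - apply: emeasurable_funD; apply: measurable_funeM; first exact/measurable_EFinP.
    by apply: emeasurable_sum => i; exact/measurable_EFinP.
  by move=> w _; rewrite sumEFin -!EFinM -EFinD lee_fin lacunary_le_test_fun.
rewrite ge0_integralD//; last 4 first.
- by move=> w _; rewrite mule_ge0 ?lee_fin ?test_fun_ge0.
- by apply: measurable_funeM; exact/measurable_EFinP.
- by move=> w _; rewrite mule_ge0// sume_ge0.
- by apply: measurable_funeM; apply: emeasurable_sum => i; exact/measurable_EFinP.
rewrite ge0_integralZl_EFin//; last 2 first.
- by move=> w _; rewrite lee_fin test_fun_ge0.
- exact/measurable_EFinP.
rewrite ge0_integralZl_EFin//; last 2 first.
- by move=> w _; exact: sume_ge0.
- by apply: emeasurable_sum => i; exact/measurable_EFinP.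
rewrite [leRHS]EFinD [X in (_ <= X + _)%E]EFinM sE fineK ?integrable_fin_num//; apply: leeD => //.
rewrite ge0_integral_sum//; last by move=> i; exact/measurable_EFinP.
apply: (@le_trans _ _ (4%:E * \sum_(i < d) (64 * t)%:E)%E).
  by rewrite lee_wpmul2l//; apply: lee_sum => i _; exact: integral_min_sqr_le.
by rewrite sumEFin -EFinM lee_fin sumr_const card_ord -mulr_natr; lra.
Qed.

End CauchyEstimates.

(** * Unboundedness of the difference quotient at the origin *)

(** Bounded nondecreasing partial sums would converge, against the divergence of the harmonic
    series. *)
Lemma harmonic_sum_unbounded (R : realType) (K : R) :
  exists n, K < \sum_(k < n) (k.+1%:R)^-1.
Proof.
apply: contrapT => /forallNP h; apply: (@dvg_harmonic R).
apply: nondecreasing_is_cvgn.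
  apply/nondecreasing_seqP => n; rewrite !seriesEnat/= big_nat_recr//= lerDl.
  exact: harmonic_ge0.
exists K => _ [n _ <-]; rewrite seriesEnat/= big_mkord.
by rewrite leNgt; apply/negP; exact: h.
Qed.

Theorem proposition5p1 (R : realType) (d : nat) (d_gt0 : (0 < d)%N)
  (disp : measure_display) (Omega : measurableType disp)
  (P : probability Omega R) (X : R -> Omega -> 'rV[R]_d) :
  cauchy_process P X ->
  exists f : 'rV[R]_d -> R, C1_infty f /\ ~ generator_domain P X f.
Proof.
move=> hX; pose j : 'I_d := Ordinal d_gt0.
exists (test_fun j); split; first exact: C1_infty_test_fun.
move=> [g [_ _ hg]].
(* If the generator were defined, [P_t f(0) / t] would be below [g 0 + 1] for small [t]. The leading
   2 offsets the loss in [1 - exp(-u) >= u / 2]. *)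
have [n hn] := harmonic_sum_unbounded (2 * (72 * (g 0 + 1) + 256 * d%:R)).
pose N (t : R) :=
  supnorm (fun x => t^-1 * (semigroup P X t (test_fun j) x - test_fun j x) - g x).
have near1 : \forall t \near (0 : R)^'+, (N t < 1)%E.
  apply: (hg [set y | (y < 1)%E]); apply: open_nbhs_nbhs.
  by split; [exact: open_ereal_lt_ereal|exact: lte01].
(* One time [t] serves both purposes: the quotient is within 1 of [g], and [t 4^k <= 1] for every
   [k < n]. *)
have /filter_ex [t [[t0 t1] ht]] : \forall t \near (0 : R)^'+,
    (0 < t /\ t <= (4 ^+ n)^-1) /\ (N t < 1)%E.
  near=> t; split; last by near: t; exact: near1.
  split; near: t; first exact: nbhs_right_gt.
  by apply: nbhs_right_le; rewrite invr_gt0 exprn_gt0.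
have {ht} : `|t^-1 * (semigroup P X t (test_fun j) 0 - test_fun j 0) - g 0| < 1.
  rewrite -lte_fin; apply: le_lt_trans ht.
  by apply: ereal_sup_ubound; exists 0.
rewrite test_fun0 subr0 ltr_norml => /andP[_ hs].
have {}hs : semigroup P X t (test_fun j) 0 <= (g 0 + 1) * t.
  by rewrite -ler_pdivrMr// mulrC; lra.
have := semigroup_test_fun_ge hX n j (ltW t0).
apply/negP; rewrite -ltNge.
(* The upper bound linear in [t] falls strictly below [t / 2] times the harmonic sum, which the
   lacunary expectation dominates term by term. *)
apply: (@le_lt_trans _ _ ((72 * (g 0 + 1) + 256 * d%:R) * t)); first by lra.
apply: (@lt_le_trans _ _ (t / 2 * \sum_(k < n) (k.+1%:R)^-1)).
  by move: hn; nra.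
rewrite mulr_sumr; apply: ler_sum => k _.
have f0 : (0 : R) < 4 ^+ k by rewrite exprn_gt0.
have tk : 0 <= t * 4 ^+ k <= 1.
  apply/andP; split; first by apply: mulr_ge0; exact: ltW.
  rewrite -ler_pdivlMr// mul1r (le_trans t1)//.
  by rewrite lef_pV2 ?posrE ?exprn_gt0// ler_weXn2l ?ler1n// ltnW.
have := one_sub_expRN_ge tk.
have -> : t / 2 * k.+1%:R^-1 = (4 ^+ k)^-1 / k.+1%:R * (t * 4 ^+ k / 2).
  by field; rewrite !gt_eqF.
by apply: ler_wpM2l; rewrite divr_ge0.
Unshelve. all: by end_near. Qed.
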